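(* For the scheduling game on $m$ unrelated machines under the EQUI policy, the price of anarchy is at most $2m$: every Nash equilibrium has makespan at most $2m\cdot\mathrm{OPT}$.
   Context: Unrelated machines: job $i$ has an arbitrary processing time $p_{i,j}>0$ on machine $j$. A strategy profile $\sigma$ maps jobs to machines; the load of machine $j$ is $\sum_{i:\sigma(i)=j}p_{i,j}$, the makespan is the maximum load, and $\mathrm{OPT}$ is the minimum makespan over all profiles. Under EQUI (each machine processes its jobs in parallel, each unfinished job receiving an equal share of the processor) the cost of job $i$ with $\sigma(i)=j$ is $c_i=\sum_{i':\sigma(i')=j}\min\{p_{i,j},p_{i',j}\}$ (the sum includes $i$). A Nash equilibrium is a profile in which no job can strictly decrease its cost by unilaterally changing machine. *)

(* Defs.v *)
From HB Require Import structures.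
From mathcomp Require Import all_boot all_order all_algebra.

Set Implicit Arguments.
Unset Strict Implicit.
Unset Printing Implicit Defensive.

Import Order.TTheory GRing.Theory Num.Theory.
Local Open Scope ring_scope.

Section EquiGame.
Variables (R : realFieldType) (n m : nat).
Implicit Types (p : 'I_n -> 'I_m -> R) (s : {ffun 'I_n -> 'I_m}).

Definition load p s (j : 'I_m) : R := \sum_(i < n | s i == j) p i j.

(* The default 0 is harmless: loads are nonnegative when p is (makespanP). *)
Definition makespan p s : R := \big[Num.max/0]_(j < m) load p s j.

(* hm only serves to exhibit a profile, so that a minimum exists (OPTP). *)
Definition OPT (hm : (0 < m)%N) p : R :=
  makespan p [arg min_(s < [ffun=> Ordinal hm]) makespan p s]%O.

Definition equi_cost p s (i : 'I_n) : R :=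
  \sum_(k < n | s k == s i) Num.min (p i (s i)) (p k (s i)).

Definition deviate s (i : 'I_n) (j : 'I_m) : {ffun 'I_n -> 'I_m} :=
  [ffun k => if k == i then j else s k].

Definition is_nash p s : Prop :=
  forall (i : 'I_n) (j : 'I_m),
    ~ (equi_cost p (deviate s i j) i < equi_cost p s i).

Lemma makespanP p s : (0 < m)%N -> (forall i j, 0 < p i j) ->
  (exists j, makespan p s = load p s j) /\
  (forall j, load p s j <= makespan p s).
Proof.
move=> hm p_gt0.
have load_ge0 j : 0 <= load p s j by apply: sumr_ge0 => i _; apply/ltW.
have ub j : load p s j <= makespan p s by exact: le_bigmax.
split=> //.
have [|] := eqVneq (makespan p s) 0 => [ms0|].
  by exists (Ordinal hm); apply/le_anti; rewrite ub ms0 load_ge0.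
rewrite /makespan; elim/big_ind: _ => [|x y IHx IHy|j _ _].
- by rewrite eqxx.
- by case: (leP x y).
- by exists j.
Qed.

Lemma OPTP (hm : (0 < m)%N) p :
  (exists s, OPT hm p = makespan p s) /\ (forall s, OPT hm p <= makespan p s).
Proof.
rewrite /OPT; case: arg_minP => // s _ s_min.
by split=> [|t]; [exists s | exact: s_min].
Qed.

End EquiGame.

(* Main.v *)
Require Import Defs.
From HB Require Import structures.
From mathcomp Require Import all_boot all_order all_algebra.
From mathcomp Require Import lra.

(** Let [q i] be the smallest processing time of job [i], attained on machine
    [Q i].  In a Nash equilibrium every job satisfies
      [c_i <= \sum_k min (q i) (q k) + (q i + \sum_(k | q k < q i) q k)],
    by induction on the rank of [q i]: compare [c_i] with the cost of moving to
    [Q i], and bound the latter by [q i] plus the cost of the job [b] with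
    longest processing time on [Q i] among the jobs there with [q b < q i]
    (plus a term that telescopes along the induction).
    Hence [c_i <= 2 * \sum_k q k], whereas [\sum_k q k <= m * OPT].  The makespan
    is the cost of the longest job on the most loaded machine. *)

Set Implicit Arguments.
Unset Strict Implicit.
Unset Printing Implicit Defensive.

Import Order.TTheory GRing.Theory Num.Theory.
Local Open Scope ring_scope.

Section EquiNash.
Variables (R : realFieldType) (n m : nat) (p : 'I_n -> 'I_m -> R).
Hypothesis p_gt0 : forall i j, 0 < p i j.
Implicit Types (s t : {ffun 'I_n -> 'I_m}) (i k : 'I_n) (j : 'I_m).

Lemma nash_cost_le s i j : is_nash p s ->
  equi_cost p s i
    <= p i j + \sum_(k | (k != i) && (s k == j)) Num.min (p i j) (p k j).
Proof.
move=> /(_ i j)/negP; rewrite -leNgt => /le_trans; apply.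
rewrite /equi_cost !ffunE eqxx (bigD1 i) /= ?ffunE ?eqxx // minxx lerD2l.
rewrite le_eqVlt; apply/orP; left; apply/eqP; apply: eq_bigl => k.
by rewrite ffunE andbC; case: eqVneq.
Qed.

(** For a longest job on [j], each minimum in its cost is the other job's own time. The value 0
    covers a machine without jobs. *)
Lemma load_eq0_or_cost s j :
  load p s j = 0 \/ exists i, load p s j = equi_cost p s i.
Proof.
case: (pickP (fun i => s i == j)) => [i0 si0|noj]; last first.
  by left; rewrite /load big_pred0.
right; have [i /eqP si imax] :=
  @arg_maxP _ _ _ i0 (fun i => s i == j) (fun i => p i j) si0.
exists i; rewrite /load /equi_cost si; apply: eq_bigr => k /imax kle.
by rewrite min_r.
Qed.

Lemma sum_load s : \sum_j load p s j = \sum_i p i (s i).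
Proof.
rewrite (partition_big s xpredT) //=; apply: eq_bigr => j _.
by rewrite /load; apply: eq_bigr => i /eqP ->.
Qed.

Lemma sum_time_le_makespan s : \sum_i p i (s i) <= m%:R * makespan p s.
Proof.
rewrite -sum_load mulr_natl -[X in _ *+ X]card_ord -sumr_const.
by apply: ler_sum => j _; apply: le_bigmax.
Qed.

Section FastestMachine.
Variable Q : 'I_n -> 'I_m.
Hypothesis Qmin : forall i j, p i (Q i) <= p i j.
Let q i := p i (Q i).

Definition capped_total (x : R) : R := \sum_k Num.min x (q k).
Definition shorter_total i : R := q i + \sum_(k | q k < q i) q k.

Let q_ge0 i : 0 <= q i. Proof. exact: ltW (p_gt0 _ _). Qed.
#[local] Hint Resolve q_ge0 : core.

Lemma shorter_total_ge0 i : 0 <= shorter_total i.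
Proof. by rewrite /shorter_total addr_ge0 // sumr_ge0. Qed.

(** Job [k] and the jobs shorter than it are distinct jobs shorter than [i]. This absorbs the [q i]
    paid at each induction step. *)
Lemma shorter_totalD i k : q k < q i -> q i + shorter_total k <= shorter_total i.
Proof.
move=> ki; rewrite /shorter_total lerD2l [leRHS](bigD1 k) //= lerD2l.
rewrite [leRHS]big_mkcond [leLHS]big_mkcond /=; apply: ler_sum => l _.
case: ifP => [lk|_]; last by case: ifP.
by rewrite (lt_trans lk ki); case: eqVneq lk => [->|]; rewrite ?ltxx.
Qed.

Lemma capped_total_le x : capped_total x <= \sum_k q k.
Proof. by apply: ler_sum => k _; rewrite ge_min lexx orbT. Qed.

Lemma shorter_total_le i : shorter_total i <= \sum_k q k.
Proof.
rewrite /shorter_total [leRHS](bigD1 i) //= lerD2l.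
rewrite [leRHS]big_mkcond [leLHS]big_mkcond /=; apply: ler_sum => l _.
by case: (eqVneq l i) => [->|_]; rewrite ?ltxx //=; case: ifP.
Qed.

Lemma sum_min_le_cost s i b : q b < q i -> s b = Q i ->
    (forall k, s k = Q i -> q k < q i -> p k (Q i) <= p b (Q i)) ->
  \sum_(k | (k != i) && (s k == Q i)) Num.min (q i) (p k (Q i))
    <= equi_cost p s b + (capped_total (q i) - capped_total (q b)).
Proof.
move=> bi sb bmax; rewrite /equi_cost sb /capped_total -sumrB.
rewrite [X in X + _]big_mkcond -big_split [leLHS]big_mkcond /=.
apply: ler_sum => k _.
(* The comparison is made job by job; [capS] settles the jobs that contribute nothing on the
   left. *)
have capS : 0 <= Num.min (q i) (q k) - Num.min (q b) (q k).
  by rewrite subr_ge0 le_min !ge_min lexx (ltW bi) !orbT.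
case: (eqVneq (s k) (Q i)) => [sk|]; last by rewrite andbF add0r.
rewrite andbT; case: ifP => _; last first.
  by apply: addr_ge0 capS; rewrite le_min !ltW.
have [ki|] := boolP (q k < q i); last rewrite -leNgt => ik.
  rewrite (min_r (bmax k sk ki)); apply: ler_wpDr => //.
  by rewrite ge_min lexx orbT.
(* Here the left term is [q i = q b + (q i - q b)]: the cost of [b] covers [q b], since both times
   on [Q i] are at least [q b], and the capped totals differ by [q i - q b]. *)
have := Qmin k (Q i); have := Qmin b (Q i); rewrite -/(q k) -/(q b) => pb pk.
have ib : q b <= q k by apply: le_trans (ltW bi) ik.
rewrite (min_l ik) (min_l ib) (min_l (le_trans ik pk)).
by case: (leP (p b (Q i)) (p k (Q i))) => _; lra.
Qed.

Lemma nash_cost_capped s i : is_nash p s ->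
  equi_cost p s i <= capped_total (q i) + shorter_total i.
Proof.
move=> s_nash; have [r] := ubnP #|[set k | q k < q i]%R|.
elim: r i => // r IHr i; rewrite ltnS => rank_i.
apply: le_trans (nash_cost_le i (Q i) s_nash) _; rewrite -/(q i).
pose K k := (s k == Q i) && (q k < q i).
case: (pickP K) => [k0 k0P|none].
  have [b /andP[/eqP sb bi] bmax] :=
    @arg_maxP _ _ _ k0 K (fun k => p k (Q i)) k0P.
  have /IHr cb : (#|[set k | (q k < q b)%R]| < r)%N.
    apply: leq_trans rank_i; apply/proper_card/properP; split.
      by apply/subsetP => k; rewrite !inE => /lt_trans; apply.
    by exists b; rewrite !inE ?bi ?ltxx.
  have bmax' k : s k = Q i -> q k < q i -> p k (Q i) <= p b (Q i).
    by move=> sk ki; apply: bmax; rewrite /K sk eqxx.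
  (* Adding the bound [cb] for [b] cancels [capped_total (q b)]. *)
  have := sum_min_le_cost bi sb bmax'; have := shorter_totalD bi.
  by lra.
(* With no shorter job on [Q i], [capped_total (q i)] alone suffices: each other job there has
   [Num.min (q i) (q k) = q i]. *)
rewrite -[leLHS]addr0 lerD ?shorter_total_ge0 //.
rewrite /capped_total [leRHS](bigD1 i) //= minxx lerD2l.
rewrite [leRHS]big_mkcond [leLHS]big_mkcond /=; apply: ler_sum => k _.
case: (k != i) => //=; case: ifP => sk; last by rewrite le_min !q_ge0.
have := none k; rewrite /K sk /= => /negbT; rewrite -leNgt => ik.
by rewrite (min_l ik) ge_min lexx.
Qed.

Lemma nash_cost_bound s i : is_nash p s -> equi_cost p s i <= 2 * \sum_k q k.
Proof.
move=> /(@nash_cost_capped s i).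
by have := capped_total_le (q i); have := shorter_total_le i; lra.
Qed.

End FastestMachine.
End EquiNash.

Theorem theorem12 (R : realFieldType) (n m : nat) (hm : (0 < m)%N)
    (p : 'I_n -> 'I_m -> R) (p_gt0 : forall i j, 0 < p i j)
    (s : {ffun 'I_n -> 'I_m}) (s_nash : is_nash p s) :
  makespan p s <= (2 * m)%:R * OPT hm p.
Proof.
pose Q i := [arg min_(j < Ordinal hm) p i j]%O.
have Qmin i j : p i (Q i) <= p i j by rewrite /Q; case: arg_minP => // k _; apply.
have [[t ->] _] := OPTP hm p.
have [[j ->] _] := makespanP s hm p_gt0.
have opt : \sum_i p i (Q i) <= m%:R * makespan p t.
  by apply: le_trans (sum_time_le_makespan p t); apply: ler_sum.
have q_ge0 : 0 <= \sum_i p i (Q i) by apply: sumr_ge0 => i _; apply/ltW.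
rewrite natrM -mulrA.
case: (load_eq0_or_cost p s j) => [|[i]] ->; first by lra.
by have := nash_cost_bound p_gt0 Qmin i s_nash; lra.
Qed.
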